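(* Let $S$ be a finite set, let $\mathcal{T}_S=\mathcal{P}(S)$ be its power set, and let $f:\mathcal{T}_S\to\{C,A\}$ be a function such that (1) $f(\varnothing)=A$, and (2) there exists $T\in\mathcal{T}_S$ with $f(T)=C$. Suppose that $\frac12<\theta<1$. Then there exists a probability measure $\mathbb{P}_f$ on $W_S=\mathcal{T}_S\times\{G,I\}$ which $\theta$-rationalizes $f$, i.e. for every $T\in\mathcal{T}_S$, $$f(T)=C \iff \mathbb{P}_f(E_G\mid E_T)\ge\theta,$$ and such that $$\mathbb{P}_f(E_G)=\tfrac12 .$$ Moreover, $\mathbb{P}_f$ can be taken to be open-door, in the sense that $\mathbb{P}_f(E_G\mid E_T)\notin\{0,1\}$ for every $T\in\mathcal{T}_S$.
   Context: $S$ is a collection of possible testimonies; elements $T$ of $\mathcal{T}_S=\mathcal{P}(S)$ are called transcripts. A juror's disposition is a function $f:\mathcal{T}_S\to\{C,A\}$, where $C\neq A$ are two symbols ($C$ = convict, $A$ = acquit). The set of possible worlds is $W_S=\mathcal{T}_S\times\{G,I\}$, where $G\ne I$ are two symbols ($G$ = materially guilty, $I$ = materially innocent). For a transcript $T$, $E_T=\{(T,G),(T,I)\}\subseteq W_S$, and $E_G=\{(T,G): T\in\mathcal{T}_S\}\subseteq W_S$. A prior on $W_S$ is a (finitely additive) probability measure $\mathbb{P}:\mathcal{P}(W_S)\to[0,1]$. Conditional probability is $\mathbb{P}(E_G\mid E_T)=\mathbb{P}(E_G\cap E_T)/\mathbb{P}(E_T)$; statements about $\mathbb{P}(E_G\mid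 E_T)$ include the assertion that it is well defined, i.e. $\mathbb{P}(E_T)>0$. *)

(* Defs.v *)
From HB Require Import structures.
From mathcomp Require Import all_boot all_order all_algebra.
From mathcomp Require Import boolp classical_sets reals ereal measure.

Set Implicit Arguments.
Unset Strict Implicit.
Unset Printing Implicit Defensive.

Import Order.TTheory GRing.Theory Num.Theory.
Local Open Scope classical_set_scope.
Local Open Scope ring_scope.
Local Open Scope ereal_scope.

Variant verdict := Convict | Acquit.

Variant material_status := Guilty | Innocent.

Definition is_guilty (g : material_status) : bool :=
  if g is Guilty then true else false.
Definition status_of_bool (b : bool) : material_status :=
  if b then Guilty else Innocent.
Lemma is_guiltyK : cancel is_guilty status_of_bool.
Proof. by case. Qed.

HB.instance Definition _ := Finite.copy material_status (can_type is_guiltyK).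

Definition transcript (S : finType) : Type := {set S}.

Definition disposition (S : finType) : Type := transcript S -> verdict.

Definition world (S : finType) : Type := (transcript S * material_status)%type.

HB.instance Definition _ (S : finType) := Finite.on (world S).
HB.instance Definition _ (S : finType) :=
  isPointed.Build (world S) (finset.set0, Innocent).

(* Every set of worlds is an event. *)
HB.instance Definition _ (S : finType) :=
  @isMeasurable.Build default_measure_display (world S) discrete_measurable
    discrete_measurable0 discrete_measurableC discrete_measurableU.

(* A prior is only required to be finitely additive: it is a content of total
   mass 1 on the algebra of all sets of worlds. *)
Definition is_prior (R : realType) (S : finType)
    (P : {content set (world S) -> \bar R}) : Prop :=
  P [set: world S] = 1.

Definition transcript_event (S : finType) (T : transcript S) : set (world S) :=
  [set w | w.1 = T].

Definition guilt_event (S : finType) : set (world S) :=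
  [set w | w.2 = Guilty].
Arguments guilt_event : clear implicits.

Definition cond_prob (R : realType) (S : finType)
    (P : {content set (world S) -> \bar R}) (A B : set (world S)) : \bar R :=
  P (A `&` B) / P B.

(* The quotient in cond_prob is total, so any assertion about P(E_G | E_T)
   carries the condition 0 < P(E_T) that makes it well defined. *)
Definition rationalizes (R : realType) (S : finType) (theta : R)
    (P : {content set (world S) -> \bar R}) (f : disposition S) : Prop :=
  forall T : transcript S,
    f T = Convict <->
    0 < P (transcript_event T) /\
    theta%:E <= cond_prob P (guilt_event S) (transcript_event T).

Definition open_door (R : realType) (S : finType)
    (P : {content set (world S) -> \bar R}) : Prop :=
  forall T : transcript S,
    [/\ 0 < P (transcript_event T),
        cond_prob P (guilt_event S) (transcript_event T) <> 0 &
        cond_prob P (guilt_event S) (transcript_event T) <> 1].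

(* Main.v *)
Require Import Defs.
From mathcomp Require Import all_boot all_order all_algebra.
From mathcomp Require Import boolp classical_sets reals ereal measure.
From HB Require Import structures.
From mathcomp Require Import numfun ring lra.

Set Implicit Arguments.
Unset Strict Implicit.
Unset Printing Implicit Defensive.

(** Spread mass 1/2 uniformly over the convicting transcripts and mass 1/2
    uniformly over the acquitting ones; both families are nonempty. Let the
    conditional probability of guilt be theta on the former and 1 - theta on the
    latter. As 0 < 1 - theta < theta < 1, this prior is open-door and rationalizes
    f, and the total probability of guilt is theta/2 + (1 - theta)/2 = 1/2. *)

Local Open Scope ring_scope.
Import Order.TTheory GRing.Theory Num.Theory.

(** A boolean test is needed to index sums and cardinals, and [verdict] is declared without an
    equality structure. *)
Definition convicts (S : finType) (f : disposition S) (T : {set S}) : bool :=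
  if f T is Convict then true else false.

Lemma convictsP (S : finType) (f : disposition S) (T : {set S}) :
  reflect (f T = Convict) (convicts f T).
Proof. by rewrite /convicts; case: (f T); constructor. Qed.

Section WeightedPrior.
Context (R : realType) (S : finType).
Variables (m q : {set S} -> R).
Hypotheses (m_ge0 : forall T, 0 <= m T) (q01 : forall T, 0 <= q T <= 1).

(** Here [m] is the marginal weight of a transcript and [q] the chance of guilt given it. Total mass
    1 is not imposed on [m]. The sum is taken in [R], so every value is finite. *)
Definition weighted_prior (A : set (world S)) : \bar R :=
  (\sum_(T : {set S}) m T * (q T * \1_A ((T, Guilty) : world S)
                             + (1 - q T) * \1_A ((T, Innocent) : world S)))%:E.

Lemma weighted_prior_ge0 A : (0 <= weighted_prior A)%E.
Proof.
rewrite lee_fin sumr_ge0 // => T _; have /andP[q0 q1] := q01 T.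
by rewrite mulr_ge0 // addr_ge0 // mulr_ge0 // ?subr_ge0 // indicE ler0n.
Qed.

(** Each world contributes a fixed multiple of its indicator, and indicators add up on disjoint
    events; binary unions suffice. *)
Lemma weighted_prior_additive : measure_function.semi_additive weighted_prior.
Proof.
apply/additive2P.
  by congr EFin; rewrite big1 // => T _; rewrite !indicE !in_set0 /=; ring.
move=> A B _ _ AB0; rewrite /weighted_prior -EFinD -big_split /=.
have indicAB w : \1_(A `|` B)%classic w = \1_A w + \1_B w :> R.
  rewrite !indicE in_setU; case: (boolP (w \in A)); rewrite ?add0r //=.
  rewrite inE => Aw; case: (boolP (w \in B)); rewrite ?addr0 // inE => Bw.
  by have : set0 w by rewrite -AB0.
by congr EFin; apply: eq_bigr => T _; rewrite !indicAB; ring.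
Qed.

HB.instance Definition _ :=
  isContent.Build _ _ _ weighted_prior weighted_prior_ge0 weighted_prior_additive.

Definition weighted_content : {content set (world S) -> \bar R} :=
  weighted_prior.

Lemma weighted_prior_setT : weighted_prior setT = (\sum_T m T)%:E.
Proof. by congr EFin; apply: eq_bigr => T _; rewrite !indicE !mem_set //=; ring. Qed.

Lemma weighted_prior_guilt :
  weighted_prior (guilt_event S) = (\sum_T m T * q T)%:E.
Proof.
congr EFin; apply: eq_bigr => T _; rewrite !indicE mem_set // memNset //=.
by ring.
Qed.

Lemma weighted_prior_transcript T :
  weighted_prior (transcript_event T) = (m T)%:E.
Proof.
(* For [U] other than [T], neither world over [U] lies in the event, so only the summand at [T]
   survives. *)
congr EFin; rewrite (bigD1 T) //= big1 ?addr0 => [|U /eqP UT].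
  by rewrite !indicE !mem_set //=; ring.
by rewrite !indicE !memNset //=; ring.
Qed.

Lemma weighted_prior_guilt_transcript T :
  weighted_prior (guilt_event S `&` transcript_event T)%classic = (m T * q T)%:E.
Proof.
congr EFin; rewrite (bigD1 T) //= big1 ?addr0 => [|U /eqP UT].
  by rewrite !indicE mem_set // memNset => [|[]//] /=; ring.
by rewrite !indicE !memNset => [|[]//|[]//] /=; ring.
Qed.

Lemma cond_prob_weighted_content T : 0 < m T ->
  cond_prob weighted_content (guilt_event S) (transcript_event T) = (q T)%:E.
Proof.
move=> m_gt0; have m_neq0 := lt0r_neq0 m_gt0.
rewrite /cond_prob [weighted_content _]weighted_prior_guilt_transcript.
rewrite [weighted_content _]weighted_prior_transcript.
(* Extended inversion branches on whether its argument is 0; positivity of [m T] selects the real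
   inverse. *)
by rewrite inver (negPf m_neq0) -EFinM mulrAC divff // mul1r.
Qed.

End WeightedPrior.

(** The weights on [P] total 1/2; nonemptiness is what allows [#|P|] to be cancelled. *)
Lemma sum_uniform_half (R : realType) (I : finType) (P : pred I) (c : R) :
  (exists i, P i) -> \sum_(i | P i) (2 * #|P|%:R)^-1 * c = c / 2.
Proof.
case=> i Pi; have P_neq0 : #|P|%:R != 0 :> R.
  by rewrite pnatr_eq0 -lt0n; apply/card_gt0P; exists i.
by rewrite sumr_const -mulr_natl; field.
Qed.

Theorem theorem4p1 (R : realType) (S : finType) (f : disposition S)
    (hA : f finset.set0 = Acquit)
    (hC : exists T : transcript S, f T = Convict)
    (theta : R) (htheta : 2^-1 < theta < 1) :
  exists P : {content set (world S) -> \bar R},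
    [/\ is_prior P,
        rationalizes theta P f,
        P (guilt_event S) = (2^-1)%:E &
        open_door P].
Proof.
have [theta_gt theta_lt] := andP htheta.
pose acquits := [pred T : {set S} | ~~ convicts f T].
pose m T : R := if convicts f T then (2 * #|convicts f|%:R)^-1
                else (2 * #|acquits|%:R)^-1.
pose q T : R := if convicts f T then theta else 1 - theta.
have exC : exists T, convicts f T by case: hC => T /convictsP; exists T.
have exA : exists T, acquits T by exists finset.set0; rewrite /= /convicts hA.
have m_gt0 T : 0 < m T.
  rewrite /m; case: ifPn => fT; rewrite invr_gt0 mulr_gt0 // ltr0n;
  by apply/card_gt0P; exists T.
have q01 T : 0 < q T < 1 by rewrite /q; case: ifP => _; apply/andP; split; lra.
(* Used twice: with [a = b = 1] for the total mass, and with [theta], [1 - theta] for the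
   probability of guilt. *)
have sum_m (g : {set S} -> R) (a b : R) :
    (forall T, g T = if convicts f T then a else b) ->
    \sum_T m T * g T = (a + b) / 2.
  move=> gE; rewrite (bigID (convicts f)) /= mulrDl.
  rewrite -(@sum_uniform_half _ _ _ a exC) -(@sum_uniform_half _ _ _ b exA).
  congr (_ + _); apply: eq_bigr => T fT; rewrite gE /m; first by rewrite fT.
  by rewrite (negPf fT).
have m_ge0 T : 0 <= m T by exact: ltW.
have q01w T : 0 <= q T <= 1 by have /andP[/ltW -> /ltW ->] := q01 T.
pose P := weighted_content m_ge0 q01w.
have condE T := cond_prob_weighted_content m_ge0 q01w (m_gt0 T).
exists P; split.
- rewrite /is_prior [LHS]weighted_prior_setT; congr EFin.
  under eq_bigr do rewrite -[m _]mulr1.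
  by rewrite (sum_m _ 1 1) => [|T]; [field | rewrite if_same].
- move=> T; rewrite [P _]weighted_prior_transcript [cond_prob _ _ _]condE.
  rewrite lte_fin lee_fin m_gt0 /q.
  (* This is where [theta > 1/2] puts acquitting transcripts strictly below the threshold. *)
  have acquit_lt : 1 - theta < theta by lra.
  split=> [/convictsP -> //|[_]]; case: (convictsP f T) => // _.
  by rewrite leNgt acquit_lt.
- rewrite [LHS]weighted_prior_guilt (sum_m _ theta (1 - theta)) //.
  by congr EFin; field.
- move=> T; rewrite [P _]weighted_prior_transcript [cond_prob _ _ _]condE.
  rewrite lte_fin m_gt0; have /andP[q0 q1] := q01 T.
  by split=> // -[] qE; move: q0 q1; rewrite qE ltxx.
Qed.
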